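(* There exists an atomless, complete, $\sigma$-centered Boolean algebra which has no countable regular subalgebra if and only if there exists a non-principal nowhere dense ultrafilter on $\omega$.
   Context: A subalgebra $\mathbb{B}$ of a Boolean algebra $\mathbb{A}$ is regular if for every $X\subseteq\mathbb{B}$, $\sup_{\mathbb{B}}X=\mathbf{1}$ implies $\sup_{\mathbb{A}}X=\mathbf{1}$. A Boolean algebra $\mathbb{B}$ is $\sigma$-centered if $\mathbb{B}\setminus\{\mathbf{0}\}$ is the union of countably many centered families, where a family is centered if every finite subfamily has non-zero meet. A filter $D$ on $\omega$ is nowhere dense if for every function $f\colon\omega\to{}^\omega 2$ (the Cantor set) there is $A\in D$ such that $f(A)$ is nowhere dense in ${}^\omega 2$.
   Formalization: ''Countable regular subalgebra'' is read as ''countable atomless regular subalgebra'': taken literally, {0,1} is always a countable regular subalgebra, so the left side would always be false, while under CH nowhere dense ultrafilters exist. *)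

(* Defs.v *)
From HB Require Import structures.
From mathcomp Require Import all_boot all_order.
From mathcomp Require Import boolp classical_sets cardinality filter.
From mathcomp Require Import topology cantor.
Set Implicit Arguments. Unset Strict Implicit. Unset Printing Implicit Defensive.
Import Order.TTheory.
Local Open Scope classical_set_scope.
Local Open Scope order_scope.

Section BA.
Context {d : Order.disp_t} {B : ctbDistrLatticeType d}.

Definition is_sup_in (S X : set B) (s : B) : Prop :=
  [/\ S s, (forall x, X x -> x <= s) &
      (forall u, S u -> (forall x, X x -> x <= u) -> s <= u)].

Definition is_sup (X : set B) (s : B) : Prop := is_sup_in setT X s.

Definition complete_BA : Prop := forall X : set B, exists s, is_sup X s.

Definition atomless_in (S : set B) : Prop :=
  forall a, S a -> a != \bot -> exists2 b, S b & (\bot < b) && (b < a).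

Definition atomless_BA : Prop := atomless_in setT.

Definition centered (F : set B) : Prop :=
  forall s : seq B, s != [::] -> (forall x, x \in s -> F x) ->
    \meet_(x <- s) x != \bot.

Definition sigma_centered : Prop :=
  exists C : nat -> set B,
    (forall n, centered (C n)) /\
    (forall b, b != \bot -> exists n, C n b) /\
    (forall n b, C n b -> b != \bot).

Definition subalgebra (S : set B) : Prop :=
  [/\ S \bot, S \top,
      (forall x y, S x -> S y -> S (x `&` y)),
      (forall x y, S x -> S y -> S (x `|` y)) &
      (forall x, S x -> S (~` x))].

Definition regular_subalgebra (S : set B) : Prop :=
  subalgebra S /\
  forall X : set B, X `<=` S -> is_sup_in S X \top -> is_sup X \top.

End BA.

Definition nowhere_dense {T : topologicalType} (S : set T) : Prop :=
  interior (closure S) = set0.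

Definition nowhere_dense_filter (D : set_system nat) : Prop :=
  forall f : nat -> cantor_space, exists2 A, D A & nowhere_dense (f @` A).

Definition nonprincipal (D : set_system nat) : Prop :=
  forall n : nat, D <> principal_filter n.

(* Main.v *)
(* Both sides are compared with the existence of a Cohen tree: Boolean values
   [c s] of "the real extends [s]", such that no nonzero element forces the
   real to avoid a dense set of extensions. A Boolean algebra has a countable
   atomless regular subalgebra as soon as it has such a tree, and conversely.

   If no nowhere dense ultrafilter exists, cover the nonzero elements of [B] by
   ultrafilters [U n]. A countable partition disjoint from [U n], together with
   a map witnessing that the induced ultrafilter on the indices is not nowhere
   dense, gives a random finite string. Merging the pieces on which the map is
   avoidable for some other [U m] (keeping only finitely many bits there) makes
   every [U m] either choose a single piece or see a somewhere dense set of
   strings. Concatenating the strings obtained for all [n] yields a Cohen tree: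
   for each [U m], finitely many strings are decided before a somewhere dense
   one appears.

   Conversely, for an ultrafilter [D] take the clopen algebra of the countable
   extremally disconnected space of finite sequences in which a set is open iff
   it contains [D]-almost all children of each of its points. Given a tree [c],
   choose for each node [D]-many children with nowhere dense branches, and for
   the string [s] an extension [tau s ++ s] avoided by the chosen children of
   the finitely many nodes with code below that of [s]; nodes with larger code
   discard the children that enter [c (tau s ++ s)], which is possible because
   this set is clopen. The resulting open set misses every [c (tau s ++ s)]. *)
Require Import Defs.
From HB Require Import structures.
From mathcomp Require Import all_boot all_order.
From mathcomp Require Import boolp classical_sets cardinality filter.
From mathcomp Require Import topology cantor.
Local Open Scope classical_set_scope.

Set Implicit Arguments. Unset Strict Implicit. Unset Printing Implicit Defensive.
Import Order.Theory.
Local Open Scope order_scope.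

(** * Cohen trees and countable regular subalgebras *)

Lemma cat_trichotomy (T : eqType) (s t : seq T) :
  [\/ exists r, s = r ++ t, exists r, t = r ++ s |
      exists p q w i j, [/\ i != j, s = p ++ i :: w & t = q ++ j :: w]].
Proof.
elim/last_ind: s t => [|s i IH] t; first by constructor 2; exists t; rewrite cats0.
elim/last_ind: t => [|t j _]; first by constructor 1; exists (rcons s i); rewrite cats0.
have [->|ij] := eqVneq i j; last first.
  by constructor 3; exists s, t, [::], i, j; rewrite !cats1.
case: (IH t) => [[r ->]|[r ->]|[p [q [w [k [l [kl -> ->]]]]]]].
- by constructor 1; exists r; rewrite rcons_cat.
- by constructor 2; exists r; rewrite rcons_cat.
- by constructor 3; exists p, q, (rcons w j), k, l; rewrite !rcons_cat !rcons_cons.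
Qed.

Section BooleanAlgebra.
Context {d : Order.disp_t} {B : ctbDistrLatticeType d}.
Implicit Types (b e u x y : B) (s r t : seq bool) (c : seq bool -> B).

Lemma meet_eq0S x x' y y' :
  x' <= x -> y' <= y -> x `&` y = \bot -> x' `&` y' = \bot.
Proof.
by move=> xx' yy' xy0; apply/eqP; rewrite -lex0 -xy0; exact: leI2.
Qed.

Lemma sup_meet_eq0 (X : set B) u b :
  is_sup X u -> (forall x, X x -> b `&` x = \bot) -> b `&` u = \bot.
Proof.
move=> [_ _ uP] bX; apply/eqP; rewrite disj_leC lexC; apply: uP => // x Xx.
by rewrite lexC -disj_leC bX.
Qed.

Lemma sup_meet_neq0 (X : set B) u b :
  is_sup X u -> b `&` u != \bot -> exists2 x, X x & b `&` x != \bot.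
Proof.
move=> Xu /eqP bu; apply: contrapT => nX; apply: bu; apply: (sup_meet_eq0 Xu).
by move=> x Xx; apply/eqP; apply: contrapT => /negP bx; apply: nX; exists x.
Qed.

(* A name for a Cohen real: [c s] is the Boolean value of "the real extends
   [s]". Strings are read from right to left, so that extensions of [s] are
   the strings [r ++ s]. *)
Definition cohen_tree c : Prop :=
  [/\ forall i s, c (i :: s) <= c s,
      forall s, c (true :: s) `&` c (false :: s) = \bot &
      forall b, b != \bot -> exists s, forall r, b `&` c (r ++ s) != \bot].

Section FromTree.
Variables (c : seq bool -> B) (cT : cohen_tree c).

Let c_cat r s : c (r ++ s) <= c s.
Proof.
by case: cT => cS _ _; elim: r => //= i r; apply: le_trans.
Qed.

Let c_disj p q w i j : i != j -> c (p ++ i :: w) `&` c (q ++ j :: w) = \bot.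
Proof.
case: cT => _ cD _ ij; apply: meet_eq0S (c_cat _ _) (c_cat _ _) _.
by case: i j ij => [] [] //= _; rewrite // meetC.
Qed.

(** NAND alone yields every Boolean operation; [code] then embeds the terms into a countable
    type. *)
Inductive term := Leaf of seq bool | Nand of term & term.

Fixpoint eval (t : term) : B :=
  match t with
  | Leaf s => c s
  | Nand t1 t2 => ~` (eval t1 `&` eval t2)
  end.

Fixpoint code (t : term) : GenTree.tree (seq bool) :=
  match t with
  | Leaf s => GenTree.Leaf s
  | Nand t1 t2 => GenTree.Node 0 [:: code t1; code t2]
  end.

Lemma code_inj : injective code.
Proof.
elim=> [s|t1 IH1 t2 IH2] [s'|t1' t2'] //=; first by case=> ->.
by case=> /IH1-> /IH2->.
Qed.

Definition generated : set B := range eval.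

Lemma countable_generated : countable generated.
Proof.
apply: (@card_le_trans _ _ _ [set: term]); first exact: card_image_le.
by apply/countable_injP; exists (pickle \o code) => x y _ _ /(pcan_inj pickleK)/code_inj.
Qed.

Lemma subalgebra_generated : subalgebra generated.
Proof.
have gC x : generated x -> generated (~` x).
  by case=> t _ <-; exists (Nand t t); rewrite //= meetxx.
have gI x y : generated x -> generated y -> generated (x `&` y).
  move=> [t _ <-] [t' _ <-]; rewrite -[X in generated X]complK.
  by apply: gC; exists (Nand t t').
have g1 : generated (c [::]) by exists (Leaf [::]).
have g0 : generated \bot by rewrite -(meetxC (c [::])); apply: gI => //; exact: gC.
split=> //; first by rewrite -compl0; exact: gC.
move=> x y gx gy; rewrite -[_ `|` _]complK complU; apply: (gC).
by apply: gI; apply: (gC).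
Qed.

(** Induction on the term. A leaf [c t] is decided by extending [s] to [t] if they are comparable,
    and by disjointness otherwise; for a NAND, the second argument is decided above a node that
    decides the first. *)
Lemma generated_decided e s : generated e ->
  exists r, c (r ++ s) <= e \/ c (r ++ s) <= ~` e.
Proof.
case=> t _ <-{e}; elim: t s => [t|t1 IH1 t2 IH2] s /=.
  case: (cat_trichotomy s t) => [[r ->]|[r ->]|[p [q [w [i [j [ij -> ->]]]]]]].
  - by exists [::]; left => /=; exact: c_cat.
  - by exists r; left.
  - by exists [::]; right; rewrite /= -disj_leC c_disj.
have [r1 r1P] := IH1 s; have [r2 r2P] := IH2 (r1 ++ s).
exists (r2 ++ r1); rewrite -catA; rewrite complK complI.
case: r1P => [r1P|r1P]; last first.
  by left; apply: lexUl; apply: le_trans r1P; exact: c_cat.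
case: r2P => [r2P|r2P]; last by left; apply: lexUr.
by right; rewrite lexI r2P (le_trans _ r1P) // c_cat.
Qed.

(** If an upper bound [u] of [X] is not [\top], its complement meets the whole tree above some [s].
    An element of [X] meeting [c s] would lie above some [c (r ++ s)], and so would [u]; hence the
    complement of [c s] bounds [X] inside the subalgebra. *)
Lemma generated_regular : regular_subalgebra generated.
Proof.
split; first exact: subalgebra_generated.
move=> X sX [_ _ supX]; split=> // u _ uX; rewrite le1x; apply/eqP.
apply: contrapT => /eqP u1; case: cT => _ _ cohen.
have /cohen[s sP] : ~` u != \bot.
  by apply: contra_neq u1 => u0; rewrite -[u]complK u0 compl0.
have uc0 r : u `&` c (r ++ s) <> c (r ++ s).
  move=> E; have /eqP[] := sP r; rewrite -E meetA meetCx.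
  by rewrite meet0x.
have gs : generated (~` c s).
  by case: subalgebra_generated => _ _ _ _; apply; exists (Leaf s).
have /(supX _ gs) : forall x, X x -> x <= ~` c s.
  move=> e Xe; rewrite -disj_leC; apply: contrapT => /negP /cohen[t tP].
  have [r' rt] : exists r' r, r' ++ t = r ++ s.
    have [[r ->]|[r ->]|[p [q [w [i [j [ij sE tE]]]]]]] := cat_trichotomy s t.
    - by exists r, [::].
    - by exists [::], r.
    - have /eqP[] := tP [::]; rewrite /= sE tE; rewrite -meetA.
      by rewrite c_disj ?meetx0.
  have [r2 r2P] := generated_decided (r' ++ t) (sX _ Xe).
  have [r rE] : exists r, r2 ++ r' ++ t = r ++ s.
    by case: rt => r ->; exists (r2 ++ r); rewrite catA.
  case: r2P => r2P.
    apply: (uc0 r); apply/meet_idPr; rewrite -rE.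
    by apply: le_trans (uX _ Xe).
  have /eqP[] := tP (r2 ++ r'); rewrite -catA.
  by apply: meet_eq0S (leIl _ _) r2P _; rewrite meetxC.
rewrite le1x => /eqP /(congr1 Order.compl); rewrite complK compl1 => cs0.
by have /eqP[] := sP [::]; rewrite /= cs0 meetx0.
Qed.

Lemma generated_atomless : atomless_in generated.
Proof.
move=> a ga a0; case: cT => cS cD cohen; have [s sP] := cohen _ a0.
have [_ _ gI _ _] := subalgebra_generated.
exists (a `&` c (true :: s)); first by apply: gI => //; exists (Leaf (true :: s)).
rewrite lt0x (sP [:: true]) /= lt_neqAle leIl andbT.
apply/eqP => E; have /eqP[] := sP [:: false].
by rewrite /= -E -meetA cD meetx0.
Qed.

End FromTree.

Lemma regular_of_cohen_tree c : cohen_tree c ->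
  exists S : set B, [/\ regular_subalgebra S, atomless_in S & countable S].
Proof.
move=> cT; exists (generated c); split; first exact: generated_regular.
  exact: generated_atomless.
exact: countable_generated.
Qed.

(** * From a countable atomless regular subalgebra to a Cohen tree *)

Section ToTree.
Variables (S : set B) (Sreg : regular_subalgebra S).
Variables (Satom : atomless_in S) (Scount : countable S).

(** Take [e] itself if it cuts [a] properly; otherwise [a] already decides [e], and atomlessness
    supplies any proper cut. *)
Let split_by e a : S e -> S a -> a != \bot -> exists x,
  [/\ S x, a `&` x != \bot, a `&` ~` x != \bot &
      a `&` e != \bot -> forall i : bool,
        let y := a `&` (if i then x else ~` x) in
        (y <= e) \/ (y `&` e = \bot)].
Proof.
case: Sreg => [[S0 S1 SI SU SC] _] Se Sa a0.
have [ae0|ae0] := eqVneq (a `&` e) \bot;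
  last have [ae'0|ae'0] := eqVneq (a `&` ~` e) \bot.
- have [x Sx /andP[x0 xa]] := Satom Sa a0; exists x; rewrite -lt0x.
  split=> //.
    by rewrite (meet_idPr (ltW xa)).
  by rewrite disj_leC complK (lt_geF xa).
- have [x Sx /andP[x0 xa]] := Satom Sa a0; exists x; split=> //.
  + by rewrite -lt0x (meet_idPr (ltW xa)).
  + by rewrite disj_leC complK (lt_geF xa).
  + move=> _ i /=; left; apply: le_trans (leIl _ _) _.
    by rewrite -[e]complK -disj_leC ae'0.
- exists e; split=> // _ [] /=; first by left; rewrite leIr.
  by right; rewrite -meetA meetCx meetx0.
Qed.

(** The splitting at level [n] decides the [n]-th element of [S], which makes the tree dense in [S];
    regularity turns this density into the Cohen property in [B]. *)
Lemma cohen_tree_of_regular : exists c, cohen_tree c.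
Proof.
have [[S0 S1 SI SU SC] reg] := Sreg.
have [g ginj] := countable_injP _ Scount.
pose e n := xget \bot [set x | S x /\ g x = n].
have eS n : S (e n).
  by rewrite /e; case: xgetP => [x -> []|].
have ge x : S x -> e (g x) = x.
  move=> Sx; rewrite /e; case: xgetP => [y _ [Sy gy]|/(_ x)[]//].
  by apply: ginj => //; rewrite inE.
have /choice[sp spP] : forall p : nat * B, exists x, S x /\ (S p.2 -> p.2 != \bot ->
    [/\ p.2 `&` x != \bot, p.2 `&` ~` x != \bot &
      p.2 `&` e p.1 != \bot -> forall i : bool,
        let y := p.2 `&` (if i then x else ~` x) in
        (y <= e p.1) \/ (y `&` e p.1 = \bot)]).
  case=> n a /=; have [Sa|nSa] := pselect (S a); last by exists \bot; split.
  have [a0|a0] := eqVneq a \bot; first by exists \bot; split.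
  by have [x [Sx ? ? ?]] := split_by (eS n) Sa a0; exists x; split.
pose c := fix c s := if s is i :: s' then
  let x := sp (size s', c s') in c s' `&` (if i then x else ~` x) else (\top : B).
have cS s : S (c s).
  elim: s => //= i s IH; apply: SI => //.
  by have [Sx _] := spP (size s, c s); case: i => //; exact: SC.
exists c; split=> [i s|s|b b0]; first exact: leIl.
  rewrite /=; set x := sp _; apply: meet_eq0S (leIr _ _) (leIr _ _) _.
  by rewrite meetxC.
have c0 s : c s != \bot.
  elim: s => [|i s IH] /=.
    by apply: contra_neq b0 => E; apply/eqP; rewrite -lex0 -E lex1.
  by have [_ /(_ (cS s) IH)[]] := spP (size s, c s); case: i.
have cdense a : S a -> a != \bot -> exists s, c s <= a.
  (* Some node of each length meets [a]; one of length [(g a).+1] has decided [a] and thus lies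
     below it. *)
  move=> Sa a0; have cm m : exists2 s, size s = m & c s `&` a != \bot.
    elim: m => [|m [s sm sa]]; first by exists [::]; rewrite //= meet1x.
    set x := sp (size s, c s).
    have [xa|xa] := eqVneq (c s `&` x `&` a) \bot; last first.
      by exists (true :: s); [rewrite /= sm|exact: xa].
    exists (false :: s); rewrite /= -/x ?sm //; apply: contra_neq sa => xa'.
    rewrite -[c s]meetx1 -(joinxC x) meetUr meetUl xa.
    by rewrite xa' joinxx.
  have [[|i s] //= [sm] sa] := cm (g a).+1.
  have [_ /(_ (cS s) (c0 s))/= [_ _]] := spP (size s, c s).
  rewrite sm (ge _ Sa) => H; exists (i :: s) => /=; rewrite sm.
  case: (H _ i) => //.
    apply: contra_neq sa => sa; apply: meet_eq0S (lexx _) sa; exact: leIl.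
  by rewrite -sm => E; rewrite E eqxx in sa.
apply: contrapT => ns.
have nsP s : exists r, b `&` c (r ++ s) = \bot.
  apply: contrapT => nr; apply: ns; exists s => r; apply/eqP => E; apply: nr.
  by exists r.
(* For a counterexample [b], every node has an extension with value in [X], so [X] has supremum
   [\top] in [S], yet the complement of [b] bounds [X] in [B]. *)
pose X := [set x | exists2 s, x = c s & b `&` c s = \bot].
have [] := reg X.
- by move=> x [s -> _].
- split=> // u Su uX; rewrite le1x; apply/eqP; apply: contrapT => /eqP u1.
  have /(cdense _ (SC _ Su))[s sP] : ~` u != \bot.
    by apply: contra_neq u1 => u0; rewrite -[u]complK u0 compl0.
  have [r rP] := nsP s; apply/negP: (c0 (r ++ s)); apply/negPn.
  rewrite -lex0 -(meetxC u) lexI uX /=; last by exists (r ++ s).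
  apply: le_trans sP; elim: (r) => //= i r'; apply: le_trans; exact: leIl.
- move=> _ _ /(_ (~` b) I); rewrite lexC compl1 lex0 (negbTE b0) => H.
  suff: false by []; apply: H => x [s -> bs].
  by rewrite lexC -disj_leC bs.
Qed.

End ToTree.
End BooleanAlgebra.

(** * Nowhere dense subsets of the Cantor space *)

Fixpoint initial_segment (x : nat -> bool) (m : nat) : seq bool :=
  if m is k.+1 then x k :: initial_segment x k else [::].

Lemma size_initial_segment x m : size (initial_segment x m) = m.
Proof. by elim: m => //= m ->. Qed.

Lemma initial_segment_add x m k :
  exists r, initial_segment x (k + m)%N = r ++ initial_segment x m.
Proof.
elim: k => [|k [r rE]]; first by exists [::].
by exists (x (k + m)%N :: r); rewrite addSn /= rE.
Qed.

Lemma initial_segment_cat x r s :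
  initial_segment x (size (r ++ s)) = r ++ s -> initial_segment x (size s) = s.
Proof. by elim: r => //= i r IH [_ /IH]. Qed.

Lemma initial_segmentP (x y : nat -> bool) m :
  initial_segment x m = initial_segment y m <-> forall i, (i < m)%N -> x i = y i.
Proof.
elim: m => [|m IH] //=; split=> [[xy /IH xym] i|xy].
  by rewrite ltnS leq_eqVlt => /predU1P[->|/xym].
by rewrite xy //; congr cons; apply/IH => i im; apply/xy/ltnW.
Qed.

Lemma initial_segment_exists s : exists x, initial_segment x (size s) = s.
Proof.
elim: s => [|i s [x xs]]; first by exists (fun=> false).
exists (fun k => if k == size s then i else x k); rewrite /= eqxx; congr cons.
rewrite -[in RHS]xs; apply/initial_segmentP => k ks.
by rewrite (ltn_eqF ks).
Qed.

Lemma nbhs_cantorP (x : cantor_space) (V : set cantor_space) : nbhs x V <->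
  exists m, forall y, initial_segment y m = initial_segment x m -> V y.
Proof.
split.
  pose F := filter_from [set: nat] (fun m =>
     [set y : cantor_space | initial_segment y m = initial_segment x m]).
  have FF : Filter F.
    apply: filter_from_filter; first by exists 0%N.
    move=> i j _ _; exists (maxn i j) => // y /initial_segmentP yx.
    by split; apply/initial_segmentP => k km; apply: yx; rewrite leq_max km ?orbT.
  suff : F --> x by move=> /[apply] -[m _ mV]; exists m.
  apply/cvg_sup => i W; rewrite nbhsE /= => -[O [[O' _ <-] O'x] OW].
  exists i.+1 => // y /initial_segmentP yx; apply: OW => /=.
  by rewrite yx.
move=> [m mV]; suff : nbhs x [set y : cantor_space | forall i, (i < m)%N -> y i = x i].
  by apply: filterS => y yx; apply: mV; exact/initial_segmentP.
elim: m {mV} => [|m IH]; first by apply: filterS filterT => y _ i.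
have /= H := @proj_continuous _ (fun _ : nat => bool) m x [set x m].
have {}H : nbhs x [set y : cantor_space | y m = x m].
  by apply: H.
apply: filterS (filterI IH H) => y [yx ym] i.
by rewrite ltnS leq_eqVlt => /predU1P[->|/yx].
Qed.

(* The combinatorial form of [nowhere_dense], see [nowhere_denseP]. *)
Definition avoidable (S : set (nat -> bool)) : Prop :=
  forall s, exists r, forall x, S x ->
    initial_segment x (size (r ++ s)) <> r ++ s.

Lemma nowhere_denseP (S : set cantor_space) : nowhere_dense S <-> avoidable S.
Proof.
split=> [S0 s|Sav].
  apply: contrapT => ns.
  have [x xs] := initial_segment_exists s.
  suff : interior (closure S) (x : cantor_space) by rewrite S0.
  apply/nbhs_cantorP; exists (size s) => y; rewrite xs => ys V /nbhs_cantorP[m mV].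
  apply: contrapT => SV; apply: ns.
  have [r rE] := initial_segment_add y (size s) m.
  exists r => z Sz zr; apply: SV; exists z; split => //.
  apply: mV; have /initial_segmentP zy :
      initial_segment z (m + size s)%N = initial_segment y (m + size s)%N.
    have sz : size (r ++ s) = (m + size s)%N.
      by rewrite -[RHS](size_initial_segment y) rE ys.
    by rewrite rE ys -sz.
  by apply/initial_segmentP => i im; apply: zy; rewrite ltn_addr.
apply/seteqP; split=> // x /nbhs_cantorP[m mS].
have [r rP] := Sav (initial_segment x m).
have [y yr] := initial_segment_exists (r ++ initial_segment x m).
have /mS Sy : initial_segment y m = initial_segment x m.
  by move/initial_segment_cat : yr; rewrite size_initial_segment.
have [|z [Sz /= zy]] := Sy [set z : cantor_space |
  initial_segment z (size (r ++ initial_segment x m)) = r ++ initial_segment x m].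
  by apply/nbhs_cantorP; exists (size (r ++ initial_segment x m)) => z /= ->.
exact: rP Sz zy.
Qed.

Lemma avoidableU S S' : avoidable S -> avoidable S' -> avoidable (S `|` S').
Proof.
move=> Sav Sav' s; have [r rP] := Sav s; have [r' rP'] := Sav' (r ++ s).
exists (r' ++ r) => x; rewrite -catA => -[/rP|/rP'] // H /initial_segment_cat.
exact: H.
Qed.

Lemma avoidable_bigcup (S : nat -> set (nat -> bool)) m :
  (forall i, (i < m)%N -> avoidable (S i)) ->
  avoidable [set x | exists2 i, (i < m)%N & S i x].
Proof.
elim: m => [|m IH] Sav; first by move=> s; exists [::] => x [].
have H := avoidableU (IH (fun i im => Sav i (ltnW im))) (Sav m (ltnSn m)).
move=> s; have [r rP] := H s; exists r => x [i im Six]; apply: rP.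
by move: im; rewrite ltnS leq_eqVlt => /predU1P[<-|im]; [right|left; exists i].
Qed.

Lemma avoidable1 x : avoidable [set x].
Proof.
move=> s; exists [:: ~~ x (size s)] => _ -> /= [xs _].
by case: (x _) xs.
Qed.

Lemma avoidable0 : avoidable set0.
Proof. by move=> s; exists [::]. Qed.

(** * Cohen trees when no ultrafilter is nowhere dense *)

Section BooleanUltrafilter.
Context {d : Order.disp_t} {B : ctbDistrLatticeType d}.
Implicit Types (b x y z : B) (s t : seq B) (U V W C : set B).

Definition boolean_ultrafilter U : Prop :=
  [/\ ~ U \bot, forall x y, x <= y -> U x -> U y,
      forall x y, U x -> U y -> U (x `&` y) & forall x, U x \/ U (~` x)].

(** Zorn's lemma for families that keep the finite meet property together with [C]; by [Madd], a
    maximal one contains every element compatible with all these finite meets. *)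
Lemma centered_sub_ultrafilter C : (\top : B) != \bot -> centered C ->
  exists2 U, boolean_ultrafilter U & C `<=` U.
Proof.
move=> tb Ccent.
pose fip (F : set B) := forall s, (forall x, x \in s -> C x \/ F x) ->
  \meet_(x <- s) x != \bot.
have [F Ffip Ftot|M [Mfip Mmax]] := @Zorn_bigcup _ fip.
  move=> s sF.
  (* A finite list uses only one member of the chain besides [C]; the first case also covers an
     empty chain. *)
  suff [sC|[G FG sG]] : (forall x, x \in s -> C x) \/
      exists2 G, F G & forall x, x \in s -> C x \/ G x.
  - have [->|s0] := eqVneq s [::]; first by rewrite big_nil.
    exact: Ccent.
  - exact: Ffip FG _ sG.
  elim: s sF => [|x s IH] sF; first by left.
  have /IH sP : forall y, y \in s -> C y \/ (\bigcup_(X in F) X) y.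
    by move=> y ys; apply: sF; rewrite inE ys orbT.
  have [Cx|[G FG Gx]] := sF x (mem_head _ _).
    case: sP => [sC|[G FG sG]]; [left|right; exists G => //] => y.
      by rewrite inE => /predU1P[->//|/sC].
    by rewrite inE => /predU1P[->|/sG//]; left.
  right; case: sP => [sC|[H FH sH]].
    by exists G => // y; rewrite inE => /predU1P[->|/sC]; [right|left].
  have [GH|HG] := Ftot _ _ FG FH.
    by exists H => // y; rewrite inE => /predU1P[->|/sH//]; right; exact: GH.
  exists G => // y; rewrite inE => /predU1P[->|/sH[]]; [by right|by left|].
  by move=> Hy; right; exact: HG.
have Madd x : (forall s, (forall y, y \in s -> C y \/ M y) ->
    \meet_(y <- s) y `&` x != \bot) -> M x.
  move=> xP; apply: contrapT => Mx; apply: (Mmax (M `|` [set x])%classic).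
    split; first by move=> y; left.
    by move/(_ x) => H; apply: Mx; apply: H; right.
  move=> s sM.
  suff [t tM ts] : exists2 t, forall y, y \in t -> C y \/ M y &
      \meet_(y <- t) y `&` x <= \meet_(y <- s) y.
    by apply: contra_neq (xP t tM) => s0; apply/eqP; rewrite -lex0 -s0.
  elim: s sM => [|y s IH] sM; first by exists [::]; rewrite // !big_nil lex1.
  have [|t tM ts] := IH; first by move=> z zs; apply: sM; rewrite inE zs orbT.
  have [yM|->] : (C y \/ M y) \/ y = x.
  - by case: (sM y (mem_head _ _)) => [|[]]; [left; left|left; right|right].
  - exists (y :: t) => [z|]; first by rewrite inE => /predU1P[->|/tM].
    by rewrite !big_cons -meetA; exact: leI2.
  - by exists t; rewrite // big_cons lexI leIr.
have CM : C `<=` M.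
  move=> x Cx; apply: Madd => s sM; rewrite meetC.
  have := Mfip (x :: s); rewrite big_cons; apply => y.
  by rewrite inE => /predU1P[->|/sM//]; left.
have Mmeet x s : M x -> (forall y, y \in s -> C y \/ M y) ->
    x `&` \meet_(y <- s) y != \bot.
  move=> Mx sM; have := Mfip (x :: s); rewrite big_cons; apply => y.
  by rewrite inE => /predU1P[->|/sM//]; right.
exists M => //; split.
- move=> /(Mmeet _ [::])/(_ _)/eqP[] => [x|]; first by rewrite in_nil.
  by rewrite meet0x.
- move=> x y xy Mx; apply: Madd => s sM; apply: contra_neq (Mmeet _ _ Mx sM).
  by rewrite meetC => sy; exact: meet_eq0S xy (lexx _) sy.
- move=> x y Mx My; apply: Madd => s sM; rewrite meetC -meetA.
  have := Mmeet x (y :: s) Mx; rewrite big_cons; apply => z.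
  by rewrite inE => /predU1P[->|/sM//]; right.
- move=> x; apply: contrapT => /not_orP[Mx Mx'].
  have ex y : ~ M y -> exists2 s, forall z, z \in s -> C z \/ M z &
      \meet_(z <- s) z `&` y = \bot.
    move=> My; apply: contrapT => ns; apply: My; apply: Madd => s sM.
    by apply/eqP => E; apply: ns; exists s.
  have [s sM sx] := ex _ Mx; have [t tM tx] := ex _ Mx'.
  have : \meet_(z <- s ++ t) z != \bot.
    by apply: Mfip => z; rewrite mem_cat => /orP[/sM|/tM].
  rewrite big_cat /= -lex0 -(meetxC x) meetC => /negP; apply; apply: leI2.
    by rewrite -[x]complK -disj_leC tx.
  by rewrite -disj_leC sx.
Qed.

Lemma ultrafilter_neq0 U b : boolean_ultrafilter U -> U b -> b != \bot.
Proof. by case=> U0 _ _ _ Ub; apply/eqP => b0; rewrite b0 in Ub. Qed.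

Section Partition.
Variables (U : nat -> set B) (V : set B).
Hypothesis Uultra : forall n, boolean_ultrafilter (U n).
Hypothesis Ucover : forall b, b != \bot -> exists n, U n b.
Hypothesis Vultra : boolean_ultrafilter V.
Hypothesis Batom : atomless_BA (B := B).

(** Greedy choice: stage [n] adds an element of [U n] outside [V] and disjoint from the earlier
    pieces, or [\bot] if there is none. Atomlessness gives a nonzero [z] below [b] outside [V]; if
    [z] is in [U n] and misses the earlier pieces, stage [n] succeeded and [Q n] meets [z]. *)
Lemma partition_outside_ultrafilter : exists Q : nat -> B,
  [/\ forall i j, i != j -> Q i `&` Q j = \bot, forall k, ~ V (Q k) &
      forall b, b != \bot -> exists k, b `&` Q k != \bot].
Proof.
pose pick n r := xget \bot [set z | [/\ ~ V z, U n z & z `&` r = \bot]].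
pose r := fix r n : B := if n is k.+1 then r k `|` pick k (r k) else \bot.
pose Q n := pick n (r n).
have Qr n : Q n `&` r n = \bot.
  by rewrite /Q /pick; case: xgetP => [z _ []//|_]; rewrite meet0x.
have rQ i n : (i < n)%N -> Q i <= r n.
  elim: n => // n IH; rewrite ltnS leq_eqVlt => /predU1P[->|/IH H] /=.
    exact: leUr.
  by rewrite lexUl.
have Qlt i j : (i < j)%N -> Q i `&` Q j = \bot.
  by move=> ij; rewrite meetC; apply: meet_eq0S (lexx _) (rQ _ _ ij) (Qr j).
have [V0 Vup VI VC] := Vultra.
exists Q; split=> [i j|k|b b0].
- by rewrite neq_ltn => /orP[/Qlt//|/Qlt]; rewrite meetC.
- by rewrite /Q /pick; case: xgetP => [z _ []//|_].
have [z [zb z0 Vz]] : exists z, [/\ z <= b, z != \bot & ~ V z].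
  have [Vb|] := pselect (V b); last by exists b.
  have [a _ /andP[a0 ab]] := Batom I b0.
  have [Va|] := pselect (V a); last by exists a; rewrite -lt0x (ltW ab).
  exists (b `&` ~` a); split; first exact: leIl.
    by rewrite disj_leC complK (lt_geF ab).
  by move=> /(VI _ _ Va); rewrite meetCA meetxC meetx0.
have [n Uz] := Ucover z0.
have [zr|zr] := eqVneq (z `&` r n) \bot.
  exists n; have [_ _ UI _] := Uultra n.
  apply: contra_neq (ultrafilter_neq0 (Uultra n) (UI z (Q n) Uz _)) => [bQ|].
    exact: meet_eq0S zb (lexx _) bQ.
  by rewrite /Q /pick; case: xgetP => [x _ []//|/(_ z)[]].
suff [k zk] : exists k, z `&` Q k != \bot.
  by exists k; apply: contra_neq zk; apply: meet_eq0S.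
elim: n {Uz} zr => [|n IH] /=; first by rewrite meetx0 eqxx.
rewrite meetUr join_eq0 negb_and => /orP[/IH//|zn].
by exists n.
Qed.

End Partition.
End BooleanUltrafilter.

(** * Ultrafilters induced on the indices of a countable partition *)

Section JoinsOfPartition.
Context {d : Order.disp_t} {B : ctbDistrLatticeType d}.
Variables (sup : set B -> B) (supP : forall X, is_sup X (sup X)).
Variables (Q : nat -> B).
Hypothesis Qdisj : forall i j, i != j -> Q i `&` Q j = \bot.
Hypothesis Qcover : forall b, b != \bot -> exists k, b `&` Q k != \bot.
Implicit Types (b : B) (A : set nat) (W : set B).

Definition joins A : B := sup [set Q k | k in A].

Lemma le_joins A k : A k -> Q k <= joins A.
Proof. by move=> Ak; case: (supP [set Q k | k in A]) => _ H _; apply: H; exists k. Qed.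

Lemma joins_meet_neq0 A b : b `&` joins A != \bot ->
  exists2 k, A k & b `&` Q k != \bot.
Proof. by move=> /(sup_meet_neq0 (supP _))[_ [k Ak <-]]; exists k. Qed.

Lemma joinsS A A' : A `<=` A' -> joins A <= joins A'.
Proof.
move=> AA'; case: (supP [set Q k | k in A]) => _ _; apply=> // _ [k Ak <-].
by apply: le_joins; exact: AA'.
Qed.

Lemma joins_set0 : joins set0 = \bot.
Proof.
apply/eqP/negPn/negP; rewrite -[joins _]meet1x => /joins_meet_neq0[k []].
Qed.

Lemma joinsI A A' : joins A `&` joins A' <= joins (A `&` A')%classic.
Proof.
rewrite -[X in _ <= X]complK -disj_leC meetC.
apply/eqP; apply: contrapT => /eqP; rewrite meetA => /joins_meet_neq0[k A'k].
rewrite meetAC => /joins_meet_neq0[i Ai].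
have [ik|ik] := eqVneq i k; last first.
  by rewrite -meetA [Q k `&` _]meetC Qdisj ?meetx0 ?eqxx.
rewrite ik in Ai *; rewrite -meetA meetxx => /eqP; apply; apply/eqP.
by rewrite meetC disj_leC complK; apply: le_joins.
Qed.

Lemma joins_disjoint A A' : (A `&` A')%classic = set0 -> joins A `&` joins A' = \bot.
Proof.
by move=> AA'; apply/eqP; rewrite -lex0 -joins_set0 -AA'; exact: joinsI.
Qed.

(** An element of [W] disjoint from both joins would miss every piece, against [Qcover]. *)
Lemma joins_or_compl W A : boolean_ultrafilter W ->
  W (joins A) \/ W (joins (~` A)%classic).
Proof.
move=> Wu; have [W0 Wup WI WC] := Wu.
have [|WA] := WC (joins A); first by left.
have [|WA'] := WC (joins (~` A)%classic); first by right.
have /(ultrafilter_neq0 Wu)/Qcover[k] := WI _ _ WA WA'.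
rewrite -complU => /eqP[]; apply/eqP; rewrite meetC disj_leC complK.
have [Ak|nAk] := pselect (A k); first by rewrite lexUl // le_joins.
by rewrite lexUr // le_joins.
Qed.

Lemma joins_setU W A A' : boolean_ultrafilter W ->
  W (joins (A `|` A')%classic) -> W (joins A) \/ W (joins A').
Proof.
move=> Wu WAA'; have [_ Wup WI _] := Wu.
have [|WA] := joins_or_compl A Wu; first by left.
right; apply: Wup (WI _ _ WAA' WA); apply: le_trans (joinsI _ _) _.
by apply: joinsS => k [[]].
Qed.

Lemma joins_quotient_ultrafilter W : boolean_ultrafilter W ->
  UltraFilter [set A | W (joins A)].
Proof.
move=> Wu; have [W0 Wup WI _] := Wu.
have Wset0 : ~ W (joins set0) by rewrite joins_set0.
have DT : W (joins setT).
  by have [//|] := joins_or_compl set0 Wu; rewrite setC0.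
split=> [|G GF DG].
  split=> //; split=> // [A A' WA WA'|A A' /joinsS AA'].
    exact: Wup (joinsI _ _) (WI _ _ WA WA').
  exact: Wup.
apply/seteqP; split=> // A GA.
have [//|/DG GA'] := joins_or_compl A Wu.
have : G (A `&` ~` A)%classic by exact: filterI.
by rewrite setICr => /filter_ex[].
Qed.

End JoinsOfPartition.

Section Forward.
Context {d : Order.disp_t} {B : ctbDistrLatticeType d}.
Variables (sup : set B -> B) (supP : forall X, is_sup X (sup X)).
Variables (U : nat -> set B).
Hypothesis Uultra : forall n, boolean_ultrafilter (U n).
Hypothesis Ucover : forall b, b != \bot -> exists n, U n b.
Hypothesis Batom : atomless_BA (B := B).
Hypothesis no_nwd : ~ exists D : set_system nat,
  [/\ UltraFilter D, nonprincipal D & nowhere_dense_filter D].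
Implicit Types (b : B) (A : set nat) (V W : set B) (P : seq bool -> B).

(* [P s] is the Boolean value of "the string [s] is chosen"; no element of [W]
   then forces the chosen string into a nowhere dense set of strings. *)
Definition dense_at P W : Prop := forall b, W b ->
  exists s, forall r, exists r', b `&` P (r' ++ r ++ s) != \bot.

Fixpoint short_strings (n : nat) : seq (seq bool) :=
  if n is k.+1 then
    [::] :: [seq true :: s | s <- short_strings k] ++
            [seq false :: s | s <- short_strings k]
  else [:: [::]].

Lemma mem_short_strings n s : (size s <= n)%N -> s \in short_strings n.
Proof.
elim: n s => [|n IH] [|i s] //= sn; rewrite inE mem_cat; apply/orP; right.
by apply/orP; case: i; [left|right]; apply/map_f/IH.
Qed.

(** If [U n] sees a set [A n] on which [f] is avoidable, the strings chosen there have length at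
    most [n], and [U n] picks one of them. Otherwise every set seen by [U n] has a somewhere dense
    image, and this survives the truncation. *)
Lemma dense_partition V : boolean_ultrafilter V -> exists P,
  [/\ forall s t, s != t -> P s `&` P t = \bot, dense_at P V &
      forall n, dense_at P (U n) \/ exists s, U n (P s)].
Proof.
move=> Vu.
have [Q [Qdisj VQ Qcover]] := partition_outside_ultrafilter Uultra Ucover Vu Batom.
pose J := joins sup Q.
have [V0 Vup VI VC] := Vu.
(* Without such an [f], the ultrafilter that [V] induces on the indices would be nowhere dense; it
   is nonprincipal because [V] contains no piece. *)
have [f fP] : exists f : nat -> nat -> bool, forall A, V (J A) -> ~ avoidable (f @` A).
  apply: contrapT => nf; apply: no_nwd; exists [set A | V (J A)]; split.
  - exact: joins_quotient_ultrafilter Vu.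
  - move=> n Dn; apply: (VQ n).
    have : [set A | V (J A)] [set n] by rewrite Dn; apply/principal_filterP.
    apply: Vup; case: (supP [set Q k | k in [set n]]) => _ _; apply=> // _ [k -> <-].
    exact: lexx.
  - move=> f; apply: contrapT => nA; apply: nf; exists f => A VA fA; apply: nA.
    by exists A => //; apply/nowhere_denseP.
have /choice[A AP] n : exists A, avoidable (f @` A) /\
    (U n (J A) \/ forall A', U n (J A') -> ~ avoidable (f @` A')).
  have [[A [fA UA]]|nA] := pselect (exists A, avoidable (f @` A) /\ U n (J A)).
    by exists A; split=> //; left.
  exists set0; split; first by rewrite image_set0; exact: avoidable0.
  by right=> A' UA' fA'; apply: nA; exists A'.
(* The alternative [l = k] makes [lev k] defined for every [k]; adding the
   single point [f k] to an avoidable set is harmless. *)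
have /choice[lev levP] k : exists l, (A l k \/ l = k) /\
    forall i, (i < l)%N -> ~ A i k /\ i != k.
  have ex : exists l, `[< A l k \/ l = k >] by exists k; apply/asboolP; right.
  exists (ex_minn ex); case: ex_minnP => m /asboolP mP mmin; split=> // i im.
  by split=> [Ai|]; [|apply/eqP => ik]; have := mmin i; rewrite leqNgt im;
     move=> /(_ _)/negP; apply=> //; apply/asboolP; [left|right].
have levA n k : A n k -> (lev k <= n)%N.
  move=> Ank; rewrite leqNgt; apply/negP => nk.
  by have [_ /(_ _ nk)[]] := levP k.
pose P s := J [set k | initial_segment (f k) (lev k) = s].
have P_dense W : boolean_ultrafilter W ->
    (forall A', W (J A') -> ~ avoidable (f @` A')) -> dense_at P W.
  move=> Wu fW b Wb; have [W0 Wup WI WC] := Wu.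
  pose K := [set k | b `&` Q k != \bot].
  have /fW fK : W (J K).
    have [//|WK] := joins_or_compl supP Qcover K Wu.
    have /(joins_meet_neq0 supP)[k] := ultrafilter_neq0 Wu (WI _ _ Wb WK).
    by [].
  apply: contrapT => ns; apply: fK => s; apply: contrapT => nr; apply: ns.
  exists s => r.
  (* [r1] avoids all points truncated at a level up to [size (r ++ s)], so an index [k] whose [f k]
     passes through [r1 ++ r ++ s] keeps more bits than [r ++ s] has. *)
  have := @avoidable_bigcup (fun i => f @` (A i `|` [set i])%classic)
    (size (r ++ s)).+1 _ (r ++ s).
  case=> [i _|r1 r1P].
    rewrite image_setU image_set1; apply: avoidableU; last exact: avoidable1.
    by have [] := AP i.
  have [_ [[k Kk <-] kr]] : exists x, (f @` K) x /\
      initial_segment x (size (r1 ++ r ++ s)) = r1 ++ r ++ s.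
    apply: contrapT => nx; apply: nr; exists (r1 ++ r) => x Kx; rewrite -catA => xr.
    by apply: nx; exists x.
  have levk : (size (r ++ s) < lev k)%N.
    rewrite ltnNge; apply/negP => levk; apply: (r1P (f k)); last exact: kr.
    exists (lev k) => //; exists k => //.
    by have [[]] := levP k; [left|right].
  have [r' r'P] := initial_segment_add (f k) (size (r ++ s)) (lev k - size (r ++ s)).
  exists r'; apply: contra_neq Kk; apply: meet_eq0S => //.
  apply: le_joins => //=.
  by rewrite -(subnK (ltnW levk)) r'P (initial_segment_cat kr).
exists P; split.
- move=> s t st; apply: joins_disjoint => //; apply/seteqP; split=> // k [/= ks kt].
  by move: st; rewrite -ks -kt eqxx.
- exact: P_dense.
- move=> n; have [_ [UA|UA]] := AP n; last by left; exact: P_dense.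
  right; have [U0 Uup UI UC] := Uultra n.
  have : U n (J [set k | initial_segment (f k) (lev k) \in short_strings n]).
    apply: Uup UA; apply: joinsS => // k /levA kn.
    by apply: mem_short_strings; rewrite size_initial_segment.
  elim: (short_strings n) => [|s l IH].
    rewrite (_ : mkset _ = set0) ?/J ?joins_set0 //.
    by apply/seteqP; split.
  move=> H; have [|/IH//] : U n (P s) \/
      U n (J [set k | initial_segment (f k) (lev k) \in l]).
    apply: (joins_setU supP Qdisj Qcover) => //; apply: Uup H; apply: joinsS => // k /=.
    by rewrite inE => /predU1P[]; [left|right].
  by exists s.
Qed.

(** [a al] is the value of choosing the strings of [al], last stage first, at the stages below
    [size al]. Compatible lists are comparable, hence so are their concatenations, which makes the
    two successors of a node disjoint. *)
Lemma cohen_tree_exists : exists c : seq bool -> B, cohen_tree c.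
Proof.
have /choice[P PP] := fun i => dense_partition (Uultra i).
pose a := fix a (al : seq (seq bool)) : B :=
  if al is s :: al' then P (size al') s `&` a al' else \top.
pose X s := [set x | exists2 al, (exists r, flatten al = r ++ s) & x = a al].
pose c s := sup (X s).
have a_cat al be : a (al ++ be) <= a be.
  by elim: al => //= s al IH; exact: le_trans (leIr _ _) IH.
have a_disj al be : a al `&` a be != \bot ->
    (exists ga, al = ga ++ be) \/ (exists ga, be = ga ++ al).
  move=> ab.
    have [[ga E]|[ga E]|[p [q [w [s [t [st alE beE]]]]]]] := cat_trichotomy al be.
  - by left; exists ga.
  - by right; exists ga.
  - case/eqP: ab; rewrite alE beE; apply: meet_eq0S (a_cat _ _) (a_cat _ _) _ => /=.
    apply: meet_eq0S (leIl _ _) (leIl _ _) _.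
    by have [-> //] := PP (size w).
have cat_cons_inj (T : eqType) (r r' s : seq T) i j : r ++ i :: s = r' ++ j :: s -> i = j.
  move=> E; have /eqP := E; rewrite eqseq_cat; last first.
    by have /eqP := congr1 size E; rewrite !size_cat eqn_add2r => /eqP.
  by move=> /andP[_ /eqP[]].
exists c; split.
- move=> i s; case: (supP (X (i :: s))) => _ _; apply=> // _ [al [r alr] ->].
  case: (supP (X s)) => _ H _; apply: H; exists al => //.
  by exists (rcons r i); rewrite alr cat_rcons.
- move=> s; apply/eqP; apply: contrapT => /negP.
  move=> /(sup_meet_neq0 (supP _))[_ [be [r' ber] ->]]; rewrite meetC.
  move=> /(sup_meet_neq0 (supP _))[_ [al [r alr] ->]] /a_disj[[ga E]|[ga E]].
    move: ber; rewrite E flatten_cat alr catA => /cat_cons_inj; by [].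
  move: alr; rewrite E flatten_cat ber catA => /cat_cons_inj; by [].
- move=> b b0; have [n Ub] := Ucover b0.
  (* The least such [i] exists because [P n] is dense at [U n]; at each earlier stage [U n] picks a
     single string, and [al] lists these. *)
  have ex : exists i, `[< dense_at (P i) (U n) >].
    by exists n; apply/asboolP; have [] := PP n.
  case: (ex_minnP ex) => i /asboolP Pi imin.
  have [_ _ UI _] := Uultra n.
  have [al ali Ual] : exists2 al, size al = i & U n (a al).
    have : forall j, (j < i)%N -> exists s, U n (P j s).
      move=> j ji; have [_ _ /(_ n)[/asboolP/imin|//]] := PP j.
      by rewrite leqNgt ji.
    elim: (i) => [|k IH] H.
      exists [::] => //=; have [_ Uup _ _] := Uultra n; exact: Uup (lex1 b) Ub.
    have [|al alk Ual] := IH; first by move=> j jk; apply: H; exact: ltnW.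
    have [s Us] := H k (ltnSn k).
    by exists (s :: al); rewrite /= ?alk //; apply: UI.
  have [s sP] := Pi _ (UI _ _ Ub Ual).
  exists (s ++ flatten al) => r; have [r' r'P] := sP r.
  apply: contra_neq r'P => bc; rewrite -meetA; apply: meet_eq0S (lexx _) _ bc.
  case: (supP (X (r ++ s ++ flatten al))) => _ H _; apply: H.
  exists ((r' ++ r ++ s) :: al); last by rewrite /= ali meetC.
  by exists r'; rewrite /= -!catA.
Qed.

End Forward.

(** * The algebra of a nowhere dense ultrafilter *)

Section HarmonicAlgebra.
Variables (D : set_system nat) (DU : UltraFilter D).

(* The clopen subsets of the space of finite sequences in which [U] is open
   iff [D]-almost every child [n :: s] of each [s] in [U] lies in [U]. *)
Definition harmonic (U : set (seq nat)) : Prop :=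
  forall s, U s <-> D [set n | U (n :: s)].

Lemma ultraC A : D (~` A)%classic <-> ~ D A.
Proof.
split=> [nA A' |nA]; last by case: (in_ultra_setVsetC A DU).
by have : D (A `&` ~` A)%classic; [exact: filterI|rewrite setICr => /filter_ex[]].
Qed.

Lemma harmonic0 : harmonic set0.
Proof. by move=> s; split=> // /filter_ex[]. Qed.

Lemma harmonicC U : harmonic U -> harmonic (~` U)%classic.
Proof. by move=> hU s; rewrite /setC /= (hU s) -ultraC. Qed.

Lemma harmonicI U V : harmonic U -> harmonic V -> harmonic (U `&` V)%classic.
Proof.
move=> hU hV s; rewrite /setI /= (hU s) (hV s); split=> [[Us Vs]|UV].
  exact: filterI Us Vs.
by split; apply: filterS UV => n [].
Qed.

Lemma harmonicU U V : harmonic U -> harmonic V -> harmonic (U `|` V)%classic.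
Proof.
move=> hU hV; rewrite -[(_ `|` _)%classic]setCK setCU.
by apply/harmonicC/harmonicI; exact: harmonicC.
Qed.

Lemma harmonicT : harmonic setT.
Proof. by rewrite -setC0; exact/harmonicC/harmonic0. Qed.

Record harmonic_set := Harmonic { carrier :> set (seq nat); _ : harmonic carrier }.

Lemma harmonicP (a : harmonic_set) : harmonic a.
Proof. by case: a. Qed.

Lemma harmonic_set_ext (a b : harmonic_set) : carrier a = carrier b -> a = b.
Proof.
by case: a b => U hU [V hV] /= UV; subst; congr Harmonic; exact: Prop_irrelevance.
Qed.

HB.instance Definition _ := gen_eqMixin harmonic_set.
HB.instance Definition _ := gen_choiceMixin harmonic_set.

Let hmeet (a b : harmonic_set) := Harmonic (harmonicI (harmonicP a) (harmonicP b)).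
Let hjoin (a b : harmonic_set) := Harmonic (harmonicU (harmonicP a) (harmonicP b)).
Let hcompl (a : harmonic_set) := Harmonic (harmonicC (harmonicP a)).
Let hle (a b : harmonic_set) := `[< carrier a `<=` carrier b >].

Let hle_def a b : hle a b = (hmeet a b == a).
Proof.
apply/asboolP/eqP => [ab|<- s []//]; apply: harmonic_set_ext.
exact/setIidPl.
Qed.

Fact harmonic_display : Order.disp_t. Proof. exact: Order.Disp tt tt. Qed.

Let hmeetC : commutative hmeet.
Proof. by move=> *; apply: harmonic_set_ext; exact: setIC. Qed.

Let hjoinC : commutative hjoin.
Proof. by move=> *; apply: harmonic_set_ext; exact: setUC. Qed.

Let hmeetA : associative hmeet.
Proof. by move=> *; apply: harmonic_set_ext; exact: setIA. Qed.

Let hjoinA : associative hjoin.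
Proof. by move=> *; apply: harmonic_set_ext; exact: setUA. Qed.

Let hmeetUl : left_distributive hmeet hjoin.
Proof. by move=> *; apply: harmonic_set_ext; exact: setIUl. Qed.

Let hmeetxx : idempotent_op hmeet.
Proof. by move=> *; apply: harmonic_set_ext; exact: setIid. Qed.

Let hjoinKI (b a : harmonic_set) : hmeet a (hjoin a b) = a.
Proof. by apply: harmonic_set_ext; rewrite /= setIC setUK. Qed.

Let hmeetKU (b a : harmonic_set) : hjoin a (hmeet a b) = a.
Proof. by apply: harmonic_set_ext; rewrite /= setUC setIK. Qed.

HB.instance Definition _ :=
  @Order.isMeetJoinDistrLattice.Build harmonic_display harmonic_set
    hle (fun a b => (b != a) && hle a b) hmeet hjoin
    hle_def (fun _ _ => erefl)
    hmeetC hjoinC hmeetA hjoinA hjoinKI hmeetKU hmeetUl hmeetxx.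

Let hbot := Harmonic harmonic0.
Let htop := Harmonic harmonicT.

Let hle0x (a : harmonic_set) : hbot <= a.
Proof. exact/asboolP. Qed.

Let hlex1 (a : harmonic_set) : a <= htop.
Proof. exact/asboolP. Qed.

HB.instance Definition _ :=
  Order.hasBottom.Build harmonic_display harmonic_set hle0x.
HB.instance Definition _ :=
  Order.hasTop.Build harmonic_display harmonic_set hlex1.

Let hjoinxC (a : harmonic_set) : a `|` hcompl a = \top.
Proof. by apply: harmonic_set_ext; exact: setUv. Qed.

Let hmeetxC (a : harmonic_set) : a `&` hcompl a = \bot.
Proof. by apply: harmonic_set_ext; exact: setICr. Qed.

HB.instance Definition _ :=
  Order.TBDistrLattice_hasComplement.Build harmonic_display harmonic_set
    hjoinxC hmeetxC.

Implicit Types a b : harmonic_set.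

Lemma harmonic_leP a b : reflect (carrier a `<=` carrier b) (a <= b).
Proof. exact: asboolP. Qed.

Lemma carrierI a b : carrier (a `&` b) = (carrier a `&` carrier b)%classic.
Proof. by []. Qed.

Lemma harmonic_neq0P a : a != \bot <-> exists s, carrier a s.
Proof.
split=> [a0|[s sa]]; last by apply/eqP => E; rewrite E in sa.
apply: contrapT => na; move/eqP: a0; apply; apply: harmonic_set_ext.
by apply/seteqP; split=> // s sa; case: na; exists s.
Qed.

Lemma harmonic_eq0 a : a = \bot -> forall s, ~ carrier a s.
Proof. by move=> -> s. Qed.

(* Closure in that space. *)
Inductive hull (G : set (seq nat)) : set (seq nat) :=
| hull_base s of G s : hull G s
| hull_step s A of D A & (forall n, A n -> hull G (n :: s)) : hull G s.

(** Extremal disconnectedness: the closure of an open set is open, since points added by [hull_step]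
    have [D]-many children in the hull. *)
Lemma harmonic_hull (G : set (seq nat)) :
  (forall s, G s -> D [set n | G (n :: s)]) -> harmonic (hull G).
Proof.
move=> Gopen s; split=> [|Ds]; last exact: hull_step Ds _.
case=> {}s => [/Gopen Ds|A DA AG]; last exact: filterS DA.
by apply: filterS Ds => n; exact: hull_base.
Qed.

Lemma hull_sub (G V : set (seq nat)) : harmonic V -> G `<=` V -> hull G `<=` V.
Proof.
move=> hV GV s; elim=> {}s => [/GV//|A DA _ IH].
by apply/hV; exact: filterS DA.
Qed.

(** The supremum is the closure of the union. *)
Lemma harmonic_complete : complete_BA (B := harmonic_set).
Proof.
move=> X; pose G := [set s | exists2 a, X a & carrier a s].
have Gopen s : G s -> D [set n | G (n :: s)].
  move=> [a Xa /harmonicP]; apply: filterS => n na; by exists a.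
exists (Harmonic (harmonic_hull Gopen)); split=> //.
  by move=> a Xa; apply/harmonic_leP => s sa; apply: hull_base; exists a.
move=> u _ uX; apply/harmonic_leP; apply: hull_sub => [|s [a /uX/harmonic_leP au]].
  exact: harmonicP.
exact: au.
Qed.

(** Each of the countably many sequences gives one centered family: the clopen sets containing
    it. *)
Lemma harmonic_sigma_centered : sigma_centered (B := harmonic_set).
Proof.
exists (fun n => [set a | exists2 s, n = pickle s & carrier a s]); split.
  move=> n F; case: F => [//|a l] _ Fl; have [s ns _] := Fl a (mem_head _ _).
  apply/harmonic_neq0P; exists s.
  elim: (a :: l) Fl => [|x {}l IH] lF; first by rewrite big_nil.
  rewrite big_cons carrierI; split.
    have [s' ns' xs'] := lF x (mem_head _ _).
    by rewrite (_ : s = s') //; apply: (pcan_inj pickleK); rewrite -ns -ns'.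
  by apply: IH => y yl; apply: lF; rewrite inE yl orbT.
split=> [b /harmonic_neq0P[s bs]|n b [s _ bs]]; first by exists (pickle s), s.
by apply/harmonic_neq0P; exists s.
Qed.

Hypothesis Dnp : nonprincipal D.

Lemma nonprincipal_set1 n : ~ D [set n].
Proof.
move=> Dn; apply: (Dnp (n := n)); symmetry.
have [Dprop Dmax] := principal_filter_ultra n.
have [Dp /(_ _ Dprop)] := DU; apply=> A DA; apply/principal_filterP.
have : D (A `&` [set n])%classic by exact: filterI.
by move=> /filter_ex[m [Am <-]].
Qed.

Definition cone (t : seq nat) : set (seq nat) := [set s | exists r, s = r ++ t].

(** A node outside the cone has at most one child inside, namely [t], whereas [D] contains no
    singleton. *)
Lemma harmonic_cone t : harmonic (cone t).
Proof.
move=> s; split=> [[r ->]|].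
  by apply: filterS filterT => n _; exists (n :: r).
move=> Ds; apply: contrapT => ns.
have sP n : cone t (n :: s) -> t = n :: s.
  by move=> [[|i r] /= E]; [rewrite E|case: ns; exists r; case: E].
have /filter_ex[n /sP tE] := Ds; apply: (@nonprincipal_set1 n).
by apply: filterS Ds => m /sP; rewrite tE => -[].
Qed.

(** A point [s] of [a] has a child in [a], whose cone cuts off a nonzero part without [s]. *)
Lemma harmonic_atomless : atomless_BA (B := harmonic_set).
Proof.
move=> a _ /harmonic_neq0P[s sa].
have /filter_ex[n na] : D [set n | carrier a (n :: s)] by apply/harmonicP.
exists (a `&` Harmonic (harmonic_cone (n :: s))) => //.
rewrite lt0x lt_neqAle leIl andbT; apply/andP; split.
  by apply/harmonic_neq0P; exists (n :: s); split=> //; exists [::].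
apply/eqP => E; have := sa; rewrite -{1}E carrierI => -[_ [r /(congr1 size)]].
rewrite size_cat /= addnS => sr; have := leq_addl (size r) (size s).
by rewrite -ltnS -sr ltnn.
Qed.

(** * Absence of Cohen trees in this algebra *)

Hypothesis Dnwd : nowhere_dense_filter D.
Variable c : seq bool -> harmonic_set.
Hypothesis cT : cohen_tree c.

Let c_le i s p : carrier (c (i :: s)) p -> carrier (c s) p.
Proof. by case: cT => /(_ i s)/harmonic_leP H _ _; exact: H. Qed.

Let c_cat r s p : carrier (c (r ++ s)) p -> carrier (c s) p.
Proof. by elim: r => //= i r IH /c_le. Qed.

Let c_disj s p : carrier (c (true :: s)) p -> carrier (c (false :: s)) p -> False.
Proof.
by case: cT => _ /(_ s)/harmonic_eq0 /(_ p); rewrite carrierI => H _ ? ?; exact: H.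
Qed.

(** The bit is [false] also where neither extension contains [p], so every point gets an infinite
    branch even if the tree stops there. *)
Fixpoint branch_prefix (p : seq nat) (m : nat) : seq bool :=
  if m is k.+1 then
    let s := branch_prefix p k in `[< carrier (c (true :: s)) p >] :: s
  else [::].

Definition branch p (m : nat) : bool :=
  `[< carrier (c (true :: branch_prefix p m)) p >].

Lemma branchE p m : initial_segment (branch p) m = branch_prefix p m.
Proof. by elim: m => //= m ->. Qed.

Lemma mem_branch p s : carrier (c s) p -> initial_segment (branch p) (size s) = s.
Proof.
rewrite branchE; elim: s => //= i s IH cp; rewrite (IH (c_le cp)); congr cons.
case: i cp => cp; first exact/asboolP.
by apply/asboolP => cp'; exact: c_disj cp' cp.
Qed.

Let children_exist : exists A : seq nat -> set nat, forall s,
  D (A s) /\ avoidable [set branch (n :: s) | n in A s].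
Proof.
suff /choice[A AP] : forall s, exists A : set nat,
  D A /\ avoidable [set branch (n :: s) | n in A] by exists A.
move=> s; have [A DA Anwd] := Dnwd (fun n => branch (n :: s)).
by exists A; split=> //; exact/nowhere_denseP.
Qed.

Lemma no_cohen_tree : False.
Proof.
have [A AP] := children_exist.
(* The base case picks a bit that keeps the root [[::]] out; each further step avoids the chosen
   children of the node coded [j]. *)
have avoid j s : exists r, ~ carrier (c (r ++ s)) [::] /\
    forall p : seq nat, (pickle p < j)%N ->
      forall n, A p n -> ~ carrier (c (r ++ s)) (n :: p).
  elim: j => [|j [r [r0 rP]]].
    have [c0|c0] := pselect (carrier (c (true :: s)) [::]).
      by exists [:: false]; split=> // /(c_disj c0).
    by exists [:: true].
  pose q : seq nat := if unpickle j is Some p then p else [::].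
  have [_ /(_ (r ++ s))[r' r'P]] := AP q.
  exists (r' ++ r); rewrite -catA; split=> [/c_cat //|p].
  rewrite ltnS leq_eqVlt => /predU1P[pj n An|/rP pA n /pA H /c_cat //].
  have qp : q = p by rewrite /q -pj pickleK.
  by move=> /mem_branch; apply: r'P; exists n; rewrite qp.
have /choice[tau tauP] := fun s : seq bool => avoid (pickle s) s.
pose W s := carrier (c (tau s ++ s)).
(* Only the finitely many [s] with code up to that of [p] impose a condition, and [D] contains each
   one because the complement of [W s] is open. *)
pose A' p := (A p `&` [set n | forall s : seq bool, (pickle s <= pickle p)%N ->
  ~ W s p -> ~ W s (n :: p)])%classic.
have DA' p : D (A' p).
  apply: filterI; first by have [] := AP p.
  suff H m : D [set n | forall s : seq bool,
      (pickle s < m)%N -> ~ W s p -> ~ W s (n :: p)].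
    by apply: filterS (H (pickle p).+1) => n Hn s; rewrite -ltnS; exact: Hn.
  elim: m => [|m IH]; first by apply: filterS filterT => n _ s.
  pose s : seq bool := if unpickle m is Some s then s else [::].
  have Ds : D [set n | ~ W s p -> ~ W s (n :: p)].
    have [Wp|nWp] := pselect (W s p).
      by apply: filterS filterT => n _ /(_ Wp).
    have := (harmonicC (harmonicP (c (tau s ++ s))) p).1 nWp.
    by apply: filterS => n /= nW _; exact: nW.
  apply: filterS (filterI IH Ds) => n [IHn sn] s'.
  rewrite ltnS leq_eqVlt => /predU1P[s'm|/IHn//].
  by have <- : s = s' by rewrite /s -s'm pickleK.
pose U := fix U (p : seq nat) := if p is n :: q then U q /\ A' q n else True.
have UW p s : U p -> ~ W s p.
  elim: p => [|n p IH] /= => [_|[Up [An A'n]]]; first by have [] := tauP s.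
  (* Nodes coded before [s] were handled by the choice of [tau s], the others by [A']. *)
  have [ps|sp] := ltnP (pickle p) (pickle s).
    by have [_ /(_ _ ps _ An)] := tauP s.
  by apply: A'n => //; exact: IH.
have Uopen p : U p -> D [set n | U (n :: p)].
  by move=> Up; apply: filterS (DA' p) => n; split.
pose u := Harmonic (harmonic_hull Uopen).
have u0 : u != \bot by apply/harmonic_neq0P; exists [::]; exact: hull_base.
have [_ _ /(_ _ u0)[s /(_ (tau s))/harmonic_neq0P[p]]] := cT.
rewrite carrierI => -[up Wp].
by have := hull_sub (harmonicC (harmonicP (c (tau s ++ s)))) (fun q => UW q s) up.
Qed.

End HarmonicAlgebra.

Theorem theorem1 :
  (exists (d : Order.disp_t) (B : ctbDistrLatticeType d),
      [/\ @atomless_BA d B, @complete_BA d B, @sigma_centered d B &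
          ~ (exists S : set B,
               [/\ regular_subalgebra S, atomless_in S & countable S])])
  <->
  (exists D : set_system nat,
      [/\ UltraFilter D, nonprincipal D & nowhere_dense_filter D]).
Proof.
split=> [[d [B [Batom Bcomp [C [Ccent [Ccover C0]]] noS]]]|[D [DU Dnp Dnwd]]].
  apply: contrapT => noD; apply: noS.
  suff [c cT] : exists c : seq bool -> B, cohen_tree c.
    exact: regular_of_cohen_tree cT.
  (* The degenerate algebra has no ultrafilter, but there the constant tree works, as no element is
     nonzero. *)
  have [tb|tb] := eqVneq (\top : B) \bot.
    exists (fun=> \bot); split=> // [s|b]; first exact: meet0x.
    by rewrite -lex0 -tb lex1.
  have /choice[sup supP] := Bcomp.
  have /choice[U UP] n : exists U, boolean_ultrafilter U /\ C n `<=` U.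
    by have [U] := centered_sub_ultrafilter tb (Ccent n); exists U.
  apply: (cohen_tree_exists supP (U := U)) => // [n|b /Ccover[n Cb]].
    by have [] := UP n.
  by exists n; have [_] := UP n; apply.
exists harmonic_display, (harmonic_set D : ctbDistrLatticeType _); split.
- exact: harmonic_atomless.
- exact: harmonic_complete.
- exact: harmonic_sigma_centered.
- move=> [S [Sreg Satom Scount]].
  have [c cT] := cohen_tree_of_regular Sreg Satom Scount.
  exact: no_cohen_tree cT.
Qed.
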